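(* For every integer $n\ge0$, $$h^*_n(x,y;q)=\sum_{\pi\in\mathcal{FBM}(n)}\operatorname{wt}(\pi).$$
   Context: Let $0<q<1$. $(z;p)_\infty=\prod_{i\ge0}(1-zp^i)$, $(z)_\infty=(z;q)_\infty$, $(q;q)_n=\prod_{i=1}^n(1-q^i)$. The discrete big $q$-Hermite I polynomials $h_n(x,y;q)$ are defined by $\sum_{n\ge0}h_n(x,y;q)\frac{t^n}{(q;q)_n}=\frac{(t^2;q^2)_\infty(yt)_\infty}{(xt)_\infty}$ (formal power series in $t$), and $$h^*_n(x,y;q)=(1-q)^{-n/2}h_n(x\sqrt{1-q},y\sqrt{1-q};q).$$ A matching of $[n]=\{1,\dots,n\}$ is a set partition of $[n]$ in which every block has size 1 or 2; blocks of size 1 are fixed points, and blocks of size 2 are edges, written $\{u,v\}$ with $u<v$. An FB-matching is a matching in which every fixed point is colored with $x$ or with $y$; $\mathcal{FBM}(n)$ is the set of FB-matchings of $[n]$. For $\pi\in\mathcal{FBM}(n)$: $\operatorname{cr}(\pi)$ is the number of crossings, i.e. pairs of edges $\{a,b\},\{c,d\}$ with $a<c<b<d$; $\operatorname{al}(\pi)$ is the number of alignments, i.e. pairs of edges $\{a,b\},\{c,d\}$ with $a<b<c<d$. The block-word $\mathrm{bw}(\pi)=w_1\cdots w_n$ has $w_i=1$ if $i$ is a fixed point and $w_i=0$ otherwise; $\operatorname{inv}(w)$ is the number of pairs $i<j$ with $w_i>w_j$. If $\pi$ has $k$ edges and $n-2k$ fixed points, its weight is $$\operatorname{wt}(\pi)=(-1)^kq^{2\binom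 k2+2\operatorname{al}(\pi)+\operatorname{cr}(\pi)+\operatorname{inv}(\mathrm{bw}(\pi))}z_1z_2\cdots z_{n-2k},$$ where $z_i=x$ if the $i$th fixed point (in increasing order) is colored with $x$, and $z_i=-yq^{i-1}$ if it is colored with $y$. *)

(* Defs.v *)
From HB Require Import structures.
From mathcomp Require Import all_boot all_order all_algebra.
From mathcomp Require Import all_classical all_reals all_analysis.
From mathcomp Require Import complex.

Set Implicit Arguments.
Unset Strict Implicit.
Unset Printing Implicit Defensive.

Import Order.TTheory GRing.Theory Num.Theory.
Import numFieldNormedType.Exports.

Local Open Scope ring_scope.

(* A formal power series in t is the sequence of its coefficients. *)
Section FormalPowerSeries.
Variable K : fieldType.
Implicit Types f g : nat -> K.

Definition fps_mul f g : nat -> K :=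
  fun n => \sum_(i < n.+1) f i * g (n - i)%N.

Fixpoint fps_inv_seq f (n : nat) : seq K :=
  if n is m.+1 then
    let s := fps_inv_seq f m in
    rcons s (- (f 0%N)^-1 * \sum_(i < m.+1) f i.+1 * s`_(m - i))
  else [:: (f 0%N)^-1].

(* The inverse series, meaningful when f 0 != 0 (see fps_mulV). *)
Definition fps_inv f : nat -> K := fun n => (fps_inv_seq f n)`_n.

Lemma size_fps_inv_seq f n : size (fps_inv_seq f n) = n.+1.
Proof. by elim: n => //= n IHn; rewrite size_rcons IHn. Qed.

Lemma nth_fps_inv_seq f m n : (m <= n)%N -> (fps_inv_seq f n)`_m = fps_inv f m.
Proof.
elim: n => [|n IHn]; first by rewrite leqn0 => /eqP ->.
rewrite leq_eqVlt => /orP[/eqP -> //|lt_mn].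
by rewrite /= nth_rcons size_fps_inv_seq lt_mn IHn.
Qed.

Lemma fps_mulV f : f 0%N != 0 -> fps_mul f (fps_inv f) =1 fun n => (n == 0%N)%:R.
Proof.
move=> f0 [|n]; rewrite /fps_mul.
  by rewrite big_ord1 /fps_inv /= mulfV.
rewrite big_ord_recl subn0 {1}/fps_inv /= nth_rcons size_fps_inv_seq ltnn eqxx.
rewrite mulrA mulrN mulfV // mulN1r [X in - X](_ : _ =
  \sum_(i < n.+1) f (lift ord0 i) * fps_inv f (n.+1 - lift ord0 i)%N) ?addNr //.
apply: eq_bigr => i _; rewrite lift0 subSS nth_fps_inv_seq //.
exact: leq_subr.
Qed.

End FormalPowerSeries.

Section BigqHermite.
Local Open Scope classical_set_scope.

(* (z; p)_oo as a formal power series in t = 'X : the coefficients are the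
   limits, as N tends to infinity, of those of the partial products. *)
Definition pochinf (K : numFieldType) (z : {poly K}) (p : K) : nat -> K :=
  fun m => lim ((\prod_(i < N) (1 - p ^+ i *: z))`_m @[N --> \oo]).

Definition qfact (K : numFieldType) (q : K) (n : nat) : K :=
  \prod_(1 <= i < n.+1) (1 - q ^+ i).

Definition hermite (K : numFieldType) (x y q : K) (n : nat) : K :=
  qfact q n *
  fps_mul (fps_mul (pochinf 'X^2 (q ^+ 2)) (pochinf (y *: 'X) q))
          (fps_inv (pochinf (x *: 'X) q)) n.

Definition hermite_star (C : numClosedFieldType) (x y q : C) (n : nat) : C :=
  sqrtC (1 - q) ^- n * hermite (x * sqrtC (1 - q)) (y * sqrtC (1 - q)) q n.

End BigqHermite.

Section Matchings.
Local Open Scope set_scope.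
Variable n : nat.
Implicit Types P : {set {set 'I_n}}.

Definition is_matching P : bool :=
  finset.partition P [set: 'I_n] && [forall B in P, (#|B| == 1%N) || (#|B| == 2%N)].

Definition fixpts P : {set 'I_n} := [set i | [set i] \in P].

Definition edges P : {set 'I_n * 'I_n} :=
  [set e : 'I_n * 'I_n | (e.1 < e.2)%N && ([set e.1; e.2] \in P)].

(* An FB-matching is a pair (P, Y): a matching P and the set Y of its fixed
   points colored with y; the other fixed points are colored with x. *)
Definition FBM : {set {set {set 'I_n}} * {set 'I_n}} :=
  [set pi : {set {set 'I_n}} * {set 'I_n} |
    is_matching pi.1 && (pi.2 \subset fixpts pi.1)].

Definition cr P : nat :=
  #|[set ef in finset.setX (edges P) (edges P) |
     [&& ef.1.1 < ef.2.1, ef.2.1 < ef.1.2 & ef.1.2 < ef.2.2]%N]|.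

Definition al P : nat :=
  #|[set ef in finset.setX (edges P) (edges P) |
     [&& ef.1.1 < ef.1.2, ef.1.2 < ef.2.1 & ef.2.1 < ef.2.2]%N]|.

Definition bw P : n.-tuple nat := [tuple nat_of_bool (i \in fixpts P) | i < n].

Definition inv_word (w : n.-tuple nat) : nat :=
  #|[set ij : 'I_n * 'I_n |
     (ij.1 < ij.2)%N && (tnth w ij.2 < tnth w ij.1)%N]|.

(* The number of fixed points smaller than i : it is j - 1 if i is the j-th
   fixed point. *)
Definition fixpt_rank P (i : 'I_n) : nat :=
  #|[set j in fixpts P | (j < i)%N]|.

Definition wt (K : comNzRingType) (x y q : K)
    (pi : {set {set 'I_n}} * {set 'I_n}) : K :=
  let P := pi.1 in
  let k := #|edges P| in
  (-1) ^+ k * q ^+ (2 * 'C(k, 2) + 2 * al P + cr P + inv_word (bw P)) *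
  \prod_(i in fixpts P)
    (if i \in pi.2 then - (y * q ^+ fixpt_rank P i) else x).

End Matchings.

(* Main.v *)
Require Import Defs.
From mathcomp Require Import all_boot all_order all_algebra.
From mathcomp Require Import all_classical all_reals all_analysis.
From mathcomp Require Import complex ring zify.
Import Order.TTheory GRing.Theory Num.Theory.
Import numFieldNormedType.Exports.

Set Implicit Arguments.
Unset Strict Implicit.
Unset Printing Implicit Defensive.

Local Open Scope ring_scope.

(** Both sides are the sum over [k], with [2 * k <= n] and [m = n - 2 * k], of
[[
  (-1)^k q^(k (k - 1)) c(m, k) (x - y) (x - y q) ... (x - y q^(m - 1)),
]]
where [c(m, k) = (q;q)_(m + 2k) / ((q;q)_m (q^2;q^2)_k (1 - q)^k)].

On the combinatorial side, summing over the colorings of the fixed points of a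
matching with [m] fixed points gives the product of the factors [x - y q^r]
([prod_colorings] and [big_rank]). It remains to see that [c(m, k)] is the
generating function of the exponent [2 al + cr + inv] over the matchings with
[m] fixed points and [k] edges ([sum_qexponent]). Remove the largest vertex [a]. If
[a] is fixed, the exponent does not change. If [a] is joined to [j], then [a]
is in one inversion with each fixed point, the vertices before [j] that are
fixed are each in one inversion with [j], and an edge forms with [{j, a}] an
alignment (weight 2), a crossing (weight 1) or neither according as two, one or
none of its ends lie before [j]. In all, the exponent drops by [m] plus the
number of vertices before [j] ([qexponentU2]), whatever the rest of the matching
is, and the sum over [j] gives
[[
  c(m, k) = c(m - 1, k) + q^m [m + 2k - 1]_q c(m, k - 1),
]]
which the closed form of [c] satisfies ([qcountSS]). Removing the largest vertex
rather than the smallest is what makes this drop independent of the rest.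

On the analytic side, Euler's formula expands the infinite products
([pochinf_X], the limit of the finite formula [finite_euler]), and the
[q]-binomial theorem gives the coefficients of [(yt)_oo / (xt)_oo] as
[(x - y) ... (x - y q^(m - 1)) / (q;q)_m] ([cauchy_binomial]). Multiplying by
the series of [(t^2;q^2)_oo] yields [hermiteE]. After the rescaling, the powers
of [sqrt (1 - q)] combine into [(1 - q)^(-k)] ([hermite_starE]).

Matchings are taken on arbitrary subsets of ['I_n], so that removing vertices
requires no renumbering. *)

(** * The numbers [c(m, k)] *)

Section QCount.
Variables (K : numFieldType) (q : K).
Hypothesis qX_neq1 : forall i, 1 - q ^+ i.+1 != 0.

(** The [q]-count of the matchings with [m] fixed points and [k] edges. It is the
[q]-binomial coefficient of [m + 2k] over [2k], which counts the block-words by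
inversions, times the product of the odd [q]-integers up to [2k - 1], which
counts the perfect matchings by [2 al + cr]. *)
Definition qcount m k : K :=
  qfact q (m + 2 * k) / (qfact q m * qfact (q ^+ 2) k * (1 - q) ^+ k).

Lemma qfact0 (p : K) : qfact p 0 = 1.
Proof. exact: big_geq. Qed.

Lemma qfactS (p : K) m : qfact p m.+1 = qfact p m * (1 - p ^+ m.+1).
Proof. by rewrite /qfact big_nat_recr. Qed.

Lemma qfact_neq0 (p : K) m : (forall i, 1 - p ^+ i.+1 != 0) -> qfact p m != 0.
Proof.
by move=> p1; elim: m => [|m IH]; rewrite ?qfact0 ?oner_eq0 // qfactS mulf_neq0.
Qed.

Lemma sqrX_neq1 i : 1 - (q ^+ 2) ^+ i.+1 != 0.
Proof. by rewrite -exprM mulnS; exact: (qX_neq1 (2 * i).+1). Qed.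

Lemma geom_sum m : \sum_(r < m) q ^+ r = (1 - q ^+ m) / (1 - q).
Proof.
have q1 : 1 - q != 0 by exact: (qX_neq1 0).
by apply: (canRL (mulfK q1)); rewrite mulrC -opprB mulNr -subrX1 opprB.
Qed.

Lemma qcount00 : qcount 0 0 = 1.
Proof. by rewrite /qcount !qfact0 !mul1r expr0 invr1. Qed.

Lemma qcountS0 m : qcount m.+1 0 = qcount m 0.
Proof.
rewrite /qcount !muln0 !addn0 qfact0 expr0 !mulr1 !divff //; exact: qfact_neq0.
Qed.

Lemma qcount0S k : qcount 0 k.+1 = qcount 0 k * \sum_(r < (2 * k).+1) q ^+ r.
Proof.
rewrite geom_sum /qcount !add0n mulnS !qfactS -exprM mulnS (exprS (1 - q)).
have q1 : 1 - q != 0 by exact: (qX_neq1 0).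
have q2 : 1 - q ^+ (2 + 2 * k) != 0 by exact: qX_neq1.
have [Q0 D0 s0] := And3 (qfact_neq0 0 qX_neq1) (qfact_neq0 k sqrX_neq1) (expf_neq0 k q1).
move: Q0 D0 s0 q1 q2; rewrite add2n.
move: ((1 - q) ^+ k) (1 - q) (1 - q ^+ (2 * k).+2) (1 - q ^+ (2 * k).+1).
move: (qfact (q ^+ 2) k) (qfact q (2 * k)) (qfact q 0) => D Q Q0 s u v w Q0n Dn sn un vn.
by field; rewrite Q0n Dn sn un vn.
Qed.

(** With [a = q^(m + 1)] and [b = q^(2k + 2)], after clearing denominators this is
[1 - a b = (1 - a) + a (1 - b)]. *)
Lemma qcountSS m k : qcount m.+1 k.+1 = qcount m k.+1 +
  q ^+ m.+1 * (qcount m.+1 k * \sum_(r < m.+1 + (2 * k).+1) q ^+ r).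
Proof.
rewrite geom_sum /qcount !(addSn, addnS, mulnS) ?add0n.
rewrite !qfactS -exprM mulnS add2n (exprS (1 - q)).
have -> : q ^+ (m + 2 * k).+3 = q ^+ m.+1 * q ^+ (2 * k).+2.
  by rewrite -exprD; congr (_ ^+ _); lia.
have q1 : 1 - q != 0 by exact: (qX_neq1 0).
have q2 : 1 - q ^+ (2 * k).+2 != 0 by exact: qX_neq1.
have q3 : 1 - q ^+ m.+1 != 0 by exact: qX_neq1.
have [Q0 D0 s0] := And3 (qfact_neq0 m qX_neq1) (qfact_neq0 k sqrX_neq1) (expf_neq0 k q1).
move: Q0 D0 s0 q1 q2 q3.
move: ((1 - q) ^+ k) (1 - q) (q ^+ (2 * k).+2) (q ^+ m.+1) (q ^+ (m + 2 * k).+2) (q ^+ (m + 2 * k).+1).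
move: (qfact (q ^+ 2) k) (qfact q (m + 2 * k)) (qfact q m) => D Q Q0 s u v w t t' Q0n Dn sn un vn wn.
by field; rewrite Q0n Dn sn un vn wn.
Qed.

End QCount.

(** * Matchings of a subset of ['I_n] *)

Section MatchingRecursion.
Import mathcomp.boot.fintype mathcomp.boot.finset.
Local Open Scope set_scope.
Variable n : nat.
Implicit Types (A B D : {set 'I_n}) (P : {set {set 'I_n}}).

Definition matchings A : {set {set {set 'I_n}}} :=
  [set P | partition P A & [forall B in P, (#|B| == 1%N) || (#|B| == 2%N)]].

Lemma matchings_partition A P : P \in matchings A -> partition P A.
Proof. by rewrite inE => /andP[]. Qed.

Lemma matchings_block A P B :
  P \in matchings A -> B \in P -> (#|B| == 1%N) || (#|B| == 2%N).
Proof. by rewrite inE => /andP[_ /forall_inP]; apply. Qed.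

Lemma matchings_set0 : matchings set0 = [set set0].
Proof.
apply/setP => P; rewrite !inE partition_set0.
by case: eqP => //= ->; apply/forall_inP => B; rewrite inE.
Qed.

(** Adding and removing the block [B] are inverse to each other. *)
Lemma sum_matchings_with_block (V : nmodType) D B (F : {set {set 'I_n}} -> V) :
  B \subset D -> (#|B| == 1%N) || (#|B| == 2%N) ->
  \sum_(P in matchings D | B \in P) F P =
  \sum_(P in matchings (D :\: B)) F (B |: P).
Proof.
move=> sBD cB; have B0 : B != set0 by apply: contraTneq cB => ->; rewrite cards0.
rewrite (reindex_onto (fun P => B |: P) (fun P => P :\ B)) => [|P /andP[_ BP]];
  last exact: setD1K.
apply: eq_bigl => P; rewrite setU11 andbT; apply/andP/idP => [[MP /eqP PE]|MP].
  rewrite inE -{1 2}PE; apply/andP; split.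
    by rewrite partitionD1 ?setU11 // matchings_partition.
  by apply/forall_inP => C /setD1P[_]; apply: matchings_block MP.
have pP := matchings_partition MP.
have dB : [disjoint B & D :\: B].
  by rewrite -setI_eq0; apply/eqP/setP => i; rewrite !inE; case: (i \in B).
split; last first.
  apply/eqP/setU1K; apply: contra B0 => BP.
  by have := partitionS pP BP; rewrite subsetD -setI_eq0 setIid => /andP[].
rewrite inE -[D](setID D B) (setIidPr sBD) partitionU1 //=.
apply/forall_inP => C /setU1P[-> //|]; exact: matchings_block MP.
Qed.

Lemma set2_injl (a : 'I_n) : injective (fun j => [set j; a]).
Proof.
move=> i j /setP E; have := E i; rewrite !inE eqxx => /esym/orP[/eqP //|/eqP ia].
by have := E j; rewrite !inE eqxx ia orbb => /eqP ->.
Qed.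

(** The block of [a] is [{j, a}] for exactly one vertex [j], and [a] is a fixed
point when [j = a]. *)
Lemma sum_matchings_setU1 (V : nmodType) A a (F : {set {set 'I_n}} -> V) :
  a \notin A ->
  \sum_(P in matchings (a |: A)) F P =
  \sum_(P in matchings A) F ([set a] |: P) +
  \sum_(j in A) \sum_(P in matchings (A :\ j)) F ([set j; a] |: P).
Proof.
move=> aA.
have -> : \sum_(P in matchings (a |: A)) F P =
   \sum_(P in matchings (a |: A)) \sum_(j in a |: A | [set j; a] \in P) F P.
  apply: eq_bigr => P MP; have pP := matchings_partition MP.
  have covP := cover_partition pP.
  have aP : a \in cover P by rewrite covP setU11.
  have [j bE] : exists j, pblock P a = [set j; a].
    case/orP: (matchings_block MP (pblock_mem aP)) => [/cards1P|/cards2P].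
      move=> [j bE]; exists a; move: aP; rewrite -mem_pblock bE inE => /eqP <-.
      by rewrite setUid.
    move=> [j [k [jk bE]]]; move: aP; rewrite -mem_pblock bE => /set2P[]->.
      by exists k; rewrite setUC.
    by exists j.
  rewrite (big_pred1 j) // => i; apply/andP/eqP => [[_ iaP]|->].
    apply: (@set2_injl a); rewrite -bE; apply/esym/def_pblock => //.
      exact: partition_trivIset pP.
    by rewrite set22.
  have jaP : [set j; a] \in P by rewrite -bE pblock_mem.
  by split=> //; rewrite -covP; apply/bigcupP; exists [set j; a]; rewrite ?set21.
rewrite (exchange_big_dep [in a |: A]) /=; last by move=> P j _ /andP[].
have E j : j \in a |: A ->
  \sum_(P in matchings (a |: A) | (j \in a |: A) && ([set j; a] \in P)) F P =
  \sum_(P in matchings ((a |: A) :\: [set j; a])) F ([set j; a] |: P).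
  move=> jD; rewrite jD /= sum_matchings_with_block //.
    by apply/subsetP => i /set2P[]-> //; rewrite setU11.
  by rewrite cards2; case: (j != a).
rewrite (eq_bigr _ E) big_setU1 //= setUid setU1K //; congr (_ + _).
apply: eq_bigr => j jA; apply: eq_bigl => P; congr (P \in matchings _).
apply/setP => i; rewrite !inE negb_or -andbA; congr (_ && _).
by have [->|] := eqVneq i a; rewrite //= (negbTE aA).
Qed.

(** The hypothesis covers all sets that are not larger than [A], not only [A],
because removing an edge at the largest vertex deletes a second vertex. *)
Lemma ord_set_ind (Q : {set 'I_n} -> Prop) :
  Q set0 ->
  (forall A (a : 'I_n), {in A, forall i : 'I_n, (i < a)%N} ->
     (forall B, (#|B| <= #|A|)%N -> Q B) -> Q (a |: A)) ->
  forall A, Q A.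
Proof.
move=> Q0 QU A; have [m leAm] := ubnP #|A|; elim: m A leAm => // m IH A.
have [->//|/set0Pn[i iA]] := eqVneq A set0; rewrite ltnS => leAm.
pose a := [arg max_(j > i in A) (j : nat)].
have [aA amax] : a \in A /\ {in A, forall j : 'I_n, (j <= a)%N}.
  by rewrite /a; case: arg_maxnP => // j jA jmax; split.
rewrite -(setD1K aA); apply: QU => [j /setD1P[ja jA]|B leB].
  by rewrite ltn_neqAle ja amax.
by apply: IH; apply: leq_ltn_trans leB _; apply: leq_trans leAm; rewrite [leqRHS](cardsD1 a) aA.
Qed.

Lemma max_notin A (a : 'I_n) : {in A, forall i : 'I_n, (i < a)%N} -> a \notin A.
Proof. by move=> amax; apply/negP => /amax; rewrite ltnn. Qed.

(** The ranks of the elements of [A] are [0, ..., #|A| - 1], each taken once. This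
evaluates both the product of the factors [x - y q^rank] over the fixed points
and the sum of [q^rank] over the possible partners of the largest vertex. *)
Lemma big_rank (R : Type) (idx : R) (op : Monoid.com_law idx) (F : nat -> R) A :
  \big[op/idx]_(i in A) F #|[set j in A | (j < i)%N]| =
  \big[op/idx]_(r < #|A|) F r.
Proof.
elim/ord_set_ind: A => [|A a amax IH]; first by rewrite cards0 big_set0 big_ord0.
have aA := max_notin amax.
rewrite big_setU1 //= cardsU1 aA add1n big_ord_recr -IH // Monoid.mulmC; congr (op _ _).
  apply: eq_bigr => i iA; congr (F #|pred_of_set _|); apply/setP => j; rewrite !inE.
  by case: eqVneq => [->|] //=; rewrite ltnNge (ltnW (amax _ iA)) andbF.
congr (F _); apply: eq_card => i; rewrite !inE.
by case: eqVneq => [->|ia] /=; rewrite ?ltnn ?(negbTE aA) //; case iA: (i \in A); rewrite //= amax.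
Qed.

Lemma eq_edge (u v j a : 'I_n) : (u < v)%N -> (j < a)%N ->
  ([set u; v] == [set j; a]) = ((u, v) == (j, a)).
Proof.
move=> uv ja; apply/eqP/eqP => [E|[-> ->] //].
have /set2P[uE|uE] : u \in [set j; a] by rewrite -E set21.
  have /set2P[vE|->] : v \in [set j; a] by rewrite -E set22.
    by move: uv; rewrite uE vE ltnn.
  by rewrite uE.
have /set2P[vE|vE] : v \in [set j; a] by rewrite -E set22.
  by move: uv; rewrite uE vE ltnNge (ltnW ja).
by move: uv; rewrite uE vE ltnn.
Qed.

Lemma eq_set1_set2 (i u v : 'I_n) : (u < v)%N -> ([set i] == [set u; v]) = false.
Proof.
move=> uv; apply/eqP => /(congr1 (fun B : {set 'I_n} => #|B|)).
by rewrite cards1 cards2 neq_ltn uv.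
Qed.

Lemma fixptsU1 a P : fixpts ([set a] |: P) = a |: fixpts P.
Proof. by apply/setP => i; rewrite !inE (inj_eq set1_inj). Qed.

Lemma fixptsU2 (j a : 'I_n) P :
  (j < a)%N -> fixpts ([set j; a] |: P) = fixpts P.
Proof. by move=> ja; apply/setP => i; rewrite !inE eq_set1_set2. Qed.

Lemma edgesU1 a P : edges ([set a] |: P) = edges P.
Proof.
apply/setP => e; rewrite !inE; case: ltnP => //= lt_e.
by rewrite eq_sym eq_set1_set2.
Qed.

Lemma edgesU2 (j a : 'I_n) P :
  (j < a)%N -> edges ([set j; a] |: P) = (j, a) |: edges P.
Proof.
move=> ja; apply/setP => [[u v]]; rewrite !inE /=.
case: ltnP => //= uv; first by rewrite eq_edge.
by case: eqP => // -[uE vE]; move: uv; rewrite uE vE leqNgt ja.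
Qed.

Lemma fixpts_sub A P : P \in matchings A -> fixpts P \subset A.
Proof.
move=> MP; apply/subsetP => i; rewrite inE => /(partitionS (matchings_partition MP)).
by rewrite sub1set.
Qed.

Lemma edgesP A P e : P \in matchings A -> e \in edges P ->
  [/\ (e.1 < e.2)%N, e.1 \in A & e.2 \in A].
Proof.
move=> MP; rewrite inE => /andP[-> /(partitionS (matchings_partition MP)) /subsetP sA].
by split=> //; apply: sA; rewrite ?set21 ?set22.
Qed.

Lemma edges_notin_fixpts A P e : P \in matchings A -> e \in edges P ->
  (e.1 \notin fixpts P) && (e.2 \notin fixpts P).
Proof.
move=> MP; rewrite inE => /andP[lt_e eP].
have tP := partition_trivIset (matchings_partition MP).
suff nfix i : i \in [set e.1; e.2] -> i \notin fixpts P.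
  by rewrite !nfix ?set21 ?set22.
move=> ie; apply/negP; rewrite inE => iP; have := eq_set1_set2 i lt_e.
by rewrite -(def_pblock tP iP (set11 i)) (def_pblock tP eP ie) eqxx.
Qed.

Lemma edge_block_inj P :
  {in edges P &, injective (fun e : 'I_n * 'I_n => [set e.1; e.2])}.
Proof.
move=> [u v] [j a] /setIdP[/= uv _] /setIdP[/= ja _] /= /eqP.
by rewrite eq_edge // => /eqP.
Qed.

(** A vertex is either a fixed point or an end of exactly one edge: singleton
blocks correspond to fixed points and two-element blocks to edges. *)
Lemma sum_vertices (V : nmodType) A P (g : 'I_n -> V) : P \in matchings A ->
  \sum_(i in A) g i =
  \sum_(i in fixpts P) g i + \sum_(e in edges P) (g e.1 + g e.2).
Proof.
move=> MP; rewrite (set_partition_big _ (matchings_partition MP)) /=.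
rewrite (bigID (fun B : {set _} => #|B| == 1%N)) /=; congr (_ + _).
  transitivity (\sum_(B in set1 @: fixpts P) \sum_(i in B) g i).
    apply: eq_bigl => B; apply/andP/imsetP => [[BP /cards1P[i BE]] | [i iP ->]].
      by exists i; rewrite // inE -BE.
    by move: iP; rewrite inE => iP; rewrite cards1.
  rewrite big_imset; last by move=> i j _ _; apply: set1_inj.
  by apply: eq_bigr => i _; rewrite big_set1.
transitivity (\sum_(B in [set [set e.1; e.2] | e in edges P]) \sum_(i in B) g i).
  apply: eq_bigl => B; apply/andP/imsetP => [[BP nB] | [e eE ->]].
    have := matchings_block MP BP; rewrite (negbTE nB) => /cards2P[u [v [uv BE]]].
    have [lt_uv|lt_vu|/val_inj uvE] := ltngtP u v; last by rewrite uvE eqxx in uv.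
      by exists (u, v); rewrite // inE /= lt_uv -BE.
    by exists (v, u); rewrite ?inE /= ?lt_vu 1?setUC -?BE.
  by move: eE; rewrite inE => /andP[lt_e eP]; rewrite eP cards2 (negbT (ltn_eqF lt_e)).
rewrite big_imset /=; last exact: edge_block_inj.
apply: eq_bigr => e /setIdP[lt_e _].
by rewrite big_setU1 ?big_set1 // inE (negbT (ltn_eqF lt_e)).
Qed.

Lemma card_vertices A P : P \in matchings A ->
  #|A| = (#|fixpts P| + 2 * #|edges P|)%N.
Proof.
move=> MP; rewrite -sum1_card; apply: (etrans (sum_vertices (fun=> 1%N) MP)).
by congr addn; rewrite ?sum1_card // (sum_nat_const _ 2) mulnC.
Qed.

Definition edge_al (e f : 'I_n * 'I_n) := [&& e.1 < e.2, e.2 < f.1 & f.1 < f.2]%N.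
Definition edge_cr (e f : 'I_n * 'I_n) := [&& e.1 < f.1, f.1 < e.2 & e.2 < f.2]%N.

(** The inversions of the block-word, grouped by fixed point and edge: unlike the
block-word, this does not see the elements of ['I_n] outside the matched set. *)
Definition fix_inv P : nat :=
  (\sum_(i in fixpts P) \sum_(e in edges P) ((i < e.1) + (i < e.2)))%N.

(** The exponent of [q] in the weight, without the part [2 * 'C(k, 2)] that depends
only on the number of edges. *)
Definition qexponent P : nat := (2 * al P + cr P + fix_inv P)%N.

Lemma card_pairs (E : {set 'I_n * 'I_n}) (r : rel ('I_n * 'I_n)) :
  #|[set ef in setX E E | r ef.1 ef.2]| =
  (\sum_(e in E) \sum_(f in E) r e f)%N.
Proof.
rewrite pair_big /= -sum1_card big_mkcond [RHS]big_mkcond /=.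
apply: eq_bigr => -[e f] _; rewrite !inE /=.
by case: (e \in E) => //=; case: (f \in E) => //=; case: (r e f).
Qed.

Lemma alE P : al P = (\sum_(e in edges P) \sum_(f in edges P) edge_al e f)%N.
Proof. exact: (card_pairs _ edge_al). Qed.

Lemma crE P : cr P = (\sum_(e in edges P) \sum_(f in edges P) edge_cr e f)%N.
Proof. exact: (card_pairs _ edge_cr). Qed.

(** For [e0] the edge at the largest vertex, which is never on the left of an
alignment or of a crossing. *)
Lemma sum_pairsU1 (E : {set 'I_n * 'I_n}) e0 (r : rel ('I_n * 'I_n)) :
  e0 \notin E -> r e0 e0 = false -> {in E, forall f, r e0 f = false} ->
  (\sum_(e in e0 |: E) \sum_(f in e0 |: E) r e f =
   \sum_(e in E) \sum_(f in E) r e f + \sum_(e in E) r e e0)%N.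
Proof.
move=> e0E r00 r0; rewrite big_setU1 //= big1 ?add0n => [|f]; last first.
  by case/setU1P => [->|/r0 ->]; rewrite ?r00.
by rewrite -big_split; apply: eq_bigr => e eE; rewrite big_setU1 //= addnC.
Qed.

Lemma qexponentU1 A P (a : 'I_n) : P \in matchings A ->
  {in A, forall i : 'I_n, (i < a)%N} ->
  qexponent ([set a] |: P) = qexponent P.
Proof.
move=> MP amax; rewrite /qexponent !alE !crE /fix_inv !edgesU1 fixptsU1.
have aF : a \notin fixpts P.
  by apply: contra (max_notin amax) => /(subsetP (fixpts_sub MP)).
rewrite big_setU1 //= [X in (_ + (X + _))%N]big1 // => e eP.
have [_ /amax e1 /amax e2] := edgesP MP eP.
by rewrite (ltnNge a) (ltnW e1) (ltnNge a) (ltnW e2).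
Qed.

(** A vertex [i] before [j] contributes 1: the inversion with [j] if it is fixed,
and otherwise half of an alignment or the crossing of its edge with [{j, a}]. The
term [#|fixpts P|] comes from the inversions with [a]. *)
Lemma qexponentU2 A P (j a : 'I_n) : P \in matchings (A :\ j) -> j \in A ->
  {in A, forall i : 'I_n, (i < a)%N} ->
  qexponent ([set j; a] |: P) =
  (qexponent P + #|fixpts P| + #|[set i in A | (i < j)%N]|)%N.
Proof.
move=> MP jA amax; have ja := amax _ jA.
have gtF : forall u v : 'I_n, (u < v)%N -> (v < u)%N = false by move=> *; lia.
have eA e : e \in edges P -> [/\ (e.1 < e.2)%N, (e.2 < a)%N, e.1 != j & e.2 != j].
  move=> eP; have [? /setD1P[? ?] /setD1P[? ?]] := edgesP MP eP.
  by split=> //; apply: amax.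
have jaE : (j, a) \notin edges P.
  by apply/negP => /eA[/= _]; rewrite ltnn.
have -> : #|[set i in A | (i < j)%N]| =
   (\sum_(i in fixpts P) (i < j) + \sum_(e in edges P) ((e.1 < j) + (e.2 < j)))%N.
  transitivity (\sum_(i in A :\ j) (i < j))%N; last exact: sum_vertices MP.
  rewrite -sum1_card big_mkcond [RHS]big_mkcond; apply: eq_bigr => i _.
  rewrite !inE; case: eqVneq => [->|_] /=; first by rewrite ltnn andbF.
  by case: (i \in A) => //=; case: (i < j)%N.
rewrite /qexponent !alE !crE /fix_inv edgesU2 // fixptsU2 //.
rewrite !sum_pairsU1 //; first last.
- move=> f /eA[f12 f2a _ _].
  by rewrite /edge_al /= (gtF _ _ (ltn_trans f12 f2a)) andbF.
- by rewrite /edge_al /= (gtF _ _ ja) andbF.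
- by move=> f /eA[_ f2a _ _]; rewrite /edge_cr /= (gtF _ _ f2a) !andbF.
- by rewrite /edge_cr /= ltnn.
(* An edge has two, one or no ends before j according as it makes with {j, a} an
   alignment, a crossing or neither. *)
have -> : (\sum_(e in edges P) ((e.1 < j) + (e.2 < j)) =
    2 * \sum_(e in edges P) edge_al e (j, a) + \sum_(e in edges P) edge_cr e (j, a))%N.
  rewrite big_distrr -big_split; apply: eq_bigr => e /eA[e12 e2a e1j e2j].
  rewrite /edge_al /edge_cr /= e12 e2a ja /= !andbT.
  have [lt_e2j|lt_je2|/val_inj e2E] := ltngtP e.2 j; last by rewrite e2E eqxx in e2j.
    by rewrite (ltn_trans e12 lt_e2j) andbF.
  by case: (e.1 < j)%N.
have -> : (\sum_(i in fixpts P) \sum_(e in (j, a) |: edges P) ((i < e.1) + (i < e.2)) =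
    \sum_(i in fixpts P) \sum_(e in edges P) ((i < e.1) + (i < e.2)) +
    (#|fixpts P| + \sum_(i in fixpts P) (i < j)))%N.
  rewrite -sum1_card -!big_split; apply: eq_bigr => i iP; rewrite big_setU1 //=.
  have /setD1P[_ /amax ->] := subsetP (fixpts_sub MP) _ iP.
  by rewrite addnC (addnC 1%N).
by lia.
Qed.

Lemma edges_set0 : edges set0 = set0 :> {set 'I_n * 'I_n}.
Proof. by apply/setP => e; rewrite !inE andbF. Qed.

Lemma qexponent_set0 : qexponent set0 = 0%N.
Proof.
rewrite /qexponent alE crE /fix_inv edges_set0 !big_set0 big1 // => i _.
by rewrite big_set0.
Qed.

(** By removing the largest vertex [a]. With [k] edges in all, the rest of the
matching has [m - 1] fixed points if [a] is fixed, and [m] fixed points and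
[k - 1] edges if [a] is joined to some [j]; the sum over [j] is then geometric by
[big_rank]. *)
Lemma sum_qexponent (K : numFieldType) (q : K) A m k :
  (forall i, 1 - q ^+ i.+1 != 0) -> #|A| = (m + 2 * k)%N ->
  \sum_(P in matchings A | #|edges P| == k) q ^+ qexponent P = qcount q m k.
Proof.
move=> qX; elim/ord_set_ind: A m k => [|A a amax IH] m k.
  rewrite cards0 => E; have [-> ->] : m = 0%N /\ k = 0%N by lia.
  rewrite qcount00 matchings_set0 (big_pred1 set0) ?qexponent_set0 // => P.
  by rewrite /= inE; case: eqP => // ->; rewrite edges_set0 cards0.
have aA := max_notin amax; rewrite cardsU1 aA add1n => cA.
rewrite big_mkcondr /= (sum_matchings_setU1 _ aA).
under eq_bigr => P MP do rewrite edgesU1 (qexponentU1 MP amax).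
rewrite -big_mkcondr /=.
have jP j P : j \in A -> P \in matchings (A :\ j) ->
  (if #|edges ([set j; a] |: P)| == k then q ^+ qexponent ([set j; a] |: P) else 0) =
  if #|edges P|.+1 == k then q ^+ m * (q ^+ #|[set i in A | (i < j)%N]| * q ^+ qexponent P) else 0.
  move=> jA MP; rewrite edgesU2 ?amax // cardsU1 (qexponentU2 MP jA amax).
  have -> : (j, a) \notin edges P.
    by apply/negP => /(edgesP MP)[_ _ /setD1P[_]]; rewrite (negbTE aA).
  rewrite add1n; case: eqP => // kE.
  have := card_vertices MP; have := cardsD1 j A; rewrite jA => c1 c2.
  have -> : #|fixpts P| = m by lia.
  by rewrite -!exprD; congr (_ ^+ _); lia.
under [X in _ + X]eq_bigr => j jA do under eq_bigr => P MP do rewrite (jP j P jA MP).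
(* Without edges, a must be fixed. *)
case: k cA jP => [|k] cA _.
  rewrite [X in _ + X]big1 ?addr0; last by move=> j _; rewrite big1.
  by case: m cA => [|m] cA; first lia; rewrite qcountS0 //; apply: IH; lia.
have -> : \sum_(j in A) \sum_(P in matchings (A :\ j))
    (if #|edges P|.+1 == k.+1
     then q ^+ m * (q ^+ #|[set i in A | (i < j)%N]| * q ^+ qexponent P) else 0) =
    q ^+ m * (qcount q m k * \sum_(r < #|A|) q ^+ r).
  rewrite -(big_rank _ (fun r => q ^+ r)) !big_distrr /=; apply: eq_bigr => j jA.
  rewrite -(IH (A :\ j)); first last.
  - have aux c : (c.+2 = m + 2 * k.+1 -> c = m + 2 * k)%N by lia.
    by apply: aux; rewrite -cA (cardsD1 j A) jA add1n.
  - by rewrite subset_leq_card // subD1set.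
  rewrite -big_mkcondr mulr_suml mulr_sumr; apply: eq_big => // P _.
  by rewrite [q ^+ qexponent P * _]mulrC.
(* Without fixed points, a must be joined. *)
case: m cA => [|m] cA.
  rewrite big1 ?add0r => [|P /andP[MP /eqP kE]]; last first.
    by have := card_vertices MP; rewrite kE; lia.
  have -> : #|A| = (2 * k).+1 by lia.
  by rewrite qcount0S // expr0 mul1r.
rewrite qcountSS // (IH A _ m k.+1); try lia.
by have -> : #|A| = (m.+1 + (2 * k).+1)%N by lia.
Qed.

Lemma inv_wordE P : P \in matchings [set: 'I_n] -> inv_word (bw P) = fix_inv P.
Proof.
move=> MP; rewrite /inv_word /fix_inv.
transitivity (\sum_(i in fixpts P) \sum_(j in [set: 'I_n]) ((i < j) && (j \notin fixpts P)))%N.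
  rewrite pair_big /= -sum1_card big_mkcond [RHS]big_mkcond /=.
  apply: eq_bigr => -[i j] _; rewrite !inE /= !tnth_mktuple andbT.
  rewrite ![_ \in fixpts _]inE.
  by case: ([set i] \in P); case: ([set j] \in P); case: (i < j)%N.
apply: eq_bigr => i iP.
apply: etrans (sum_vertices (fun j : 'I_n => nat_of_bool ((i < j)%N && (j \notin fixpts P))) MP) _.
rewrite big1 ?add0r => [|j ->]; last by rewrite andbF.
by apply: eq_bigr => e /(edges_notin_fixpts MP)/andP[-> ->]; rewrite !andbT.
Qed.

(** Expanding the product: the factor of [i] contributes [F i] if [i] is chosen in
[Y], and [G i] otherwise. *)
Lemma prod_colorings (R : comNzRingType) D (F G : 'I_n -> R) :
  \sum_(Y : {set 'I_n} | Y \subset D) \prod_(i in D) (if i \in Y then F i else G i) =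
  \prod_(i in D) (F i + G i).
Proof.
rewrite [RHS]big_mkcond /=.
(* The factor 0 + 1 outside D kills the sets Y that are not contained in D. *)
transitivity (\prod_(i : 'I_n) ((if i \in D then F i else 0) + (if i \in D then G i else 1))).
  rewrite bigA_distr big_mkcond; apply: eq_bigr => Y _.
  case: ifP => [/subsetP sYD|/negbT/subsetPn[i iY iD]].
    rewrite big_mkcond; apply: eq_bigr => i _.
    by case: ifP => [_|/negbT iD] //; case: ifP => // /sYD; rewrite (negbTE iD).
  by rewrite (bigD1 i) //= iY (negbTE iD) mul0r.
by apply: eq_bigr => i _; case: ifP; rewrite ?add0r.
Qed.

Lemma card_edgesT P : P \in matchings [set: 'I_n] ->
  [/\ (#|edges P| < n.+1)%N, (2 * #|edges P| <= n)%N &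
      #|fixpts P| = (n - 2 * #|edges P|)%N].
Proof.
move=> /card_vertices; rewrite cardsT card_ord => nE.
have aux f e : (n = f + 2 * e -> [/\ e < n.+1, 2 * e <= n & f = n - 2 * e])%N.
  by move=> ?; split; lia.
exact: aux.
Qed.

(** The weight depends on the matching only through [qexponent] and the number of
edges once the colorings are summed, so that the matchings can be grouped by [k]. *)
Lemma sum_wt (K : numFieldType) (x y q : K) : (forall i, 1 - q ^+ i.+1 != 0) ->
  \sum_(pi in FBM n) wt x y q pi =
  \sum_(k < n.+1 | (2 * k <= n)%N)
    (-1) ^+ k * q ^+ (2 * 'C(k, 2)) * qcount q (n - 2 * k) k *
    \prod_(r < n - 2 * k) (x - y * q ^+ r).
Proof.
move=> qX; transitivity (\sum_(P in matchings [set: 'I_n])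
    (-1) ^+ #|edges P| * q ^+ (2 * 'C(#|edges P|, 2)) * q ^+ qexponent P *
    \prod_(r < #|fixpts P|) (x - y * q ^+ r)).
  transitivity (\sum_(P in matchings [set: 'I_n])
      \sum_(Y : {set 'I_n} | Y \subset fixpts P) wt x y q (P, Y)).
    by rewrite pair_big_dep /=; apply: eq_big => [[P Y]|[P Y] //]; rewrite !inE.
  apply: eq_bigr => P MP; rewrite /wt /= -mulr_sumr.
  rewrite (prod_colorings _ (fun i => - (y * q ^+ fixpt_rank P i)) (fun=> x)).
  have -> : (2 * 'C(#|edges P|, 2) + 2 * al P + cr P + inv_word (bw P) =
      2 * 'C(#|edges P|, 2) + qexponent P)%N by rewrite inv_wordE // /qexponent; lia.
  rewrite exprD mulrA; congr (_ * _).
  transitivity (\prod_(i in fixpts P) (x - y * q ^+ fixpt_rank P i)).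
    by apply: eq_bigr => i _; rewrite addrC.
  exact: (big_rank _ (fun r => x - y * q ^+ r)).
rewrite (partition_big (fun P => inord #|edges P| : 'I_n.+1)
   (fun k : 'I_n.+1 => (2 * k <= n)%N)) /=; last first.
  by move=> P /card_edgesT[ltn le2n _]; rewrite inordK.
apply: eq_bigr => k k2n.
rewrite -(@sum_qexponent _ q [set: 'I_n]) ?cardsT ?card_ord ?subnK //.
rewrite mulr_sumr mulr_suml; apply: eq_big => [P|P /andP[MP /eqP kE]].
  case MP: (P \in _) => //=; have [ltn _ _] := card_edgesT MP.
  by rewrite -val_eqE /= inordK.
have [ltn _ ->] := card_edgesT MP.
by have -> : #|edges P| = k by rewrite -kE inordK.
Qed.

End MatchingRecursion.

(** * Formal power series *)

Section SeriesAlgebra.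
Variable K : fieldType.
Implicit Types f g h : nat -> K.

(** Truncation turns products of series into products of polynomials, from which
associativity is inherited. *)
Lemma fps_mul_poly f g N n : (n <= N)%N ->
  fps_mul f g n = ((\poly_(i < N.+1) f i) * (\poly_(i < N.+1) g i))`_n.
Proof.
move=> leN; rewrite coefM; apply: eq_bigr => i _; rewrite !coef_poly.
by rewrite !ltnS !(leq_trans _ leN) ?leq_subr // -ltnS.
Qed.

Lemma eq_fps_mul f f' g g' : f =1 f' -> g =1 g' -> fps_mul f g =1 fps_mul f' g'.
Proof. by move=> ff gg n; apply: eq_bigr => i _; rewrite ff gg. Qed.

Lemma fps_mulA f g h : fps_mul f (fps_mul g h) =1 fps_mul (fps_mul f g) h.
Proof.
move=> n; pose t u : {poly K} := \poly_(i < n.+1) u i.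
transitivity ((t f * (t g * t h))`_n).
  rewrite coefM; apply: eq_bigr => i _.
  by rewrite coef_poly ltn_ord (@fps_mul_poly _ _ n) // leq_subr.
rewrite mulrA coefM; apply: eq_bigr => i _.
by rewrite [(t h)`_ _]coef_poly ltnS leq_subr (@fps_mul_poly _ _ n) // -ltnS.
Qed.

Lemma fps_mul1 f : fps_mul f (fun n => (n == 0)%:R) =1 f.
Proof.
move=> n; rewrite /fps_mul big_ord_recr /= subnn mulr1 big1 ?add0r // => i _.
by rewrite subn_eq0 leqNgt ltn_ord mulr0.
Qed.

Lemma fps_divE f g h : g 0%N != 0 -> f =1 fps_mul h g -> fps_mul f (fps_inv g) =1 h.
Proof.
move=> g0 fE n; rewrite (eq_fps_mul fE (fun=> erefl _)) -fps_mulA.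
by rewrite (eq_fps_mul (fun=> erefl _) (fps_mulV g0)) fps_mul1.
Qed.

End SeriesAlgebra.

(** * Infinite products as series *)

Section Euler.
Variables (K : numFieldType) (p : K).
Hypothesis pX_neq1 : forall i, 1 - p ^+ i.+1 != 0.

(** [(-1)^k p^(k (k - 1) / 2)] times the [p]-binomial coefficient of [N] over [k],
written so that the dependence on [N] is a product of [k] factors tending to 1.
For [N < k] the truncated subtraction makes the factor of index [N] vanish. *)
Definition euler_coef N k : K :=
  (-1) ^+ k * p ^+ 'C(k, 2) / qfact p k * \prod_(i < k) (1 - p ^+ (N - i)).

Lemma euler_coef0 N : euler_coef N 0 = 1.
Proof. by rewrite /euler_coef qfact0 big_ord0 !expr0 invr1 !mulr1. Qed.

Lemma euler_coefSS N k :
  euler_coef N.+1 k.+1 = euler_coef N k.+1 - p ^+ N * euler_coef N k.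
Proof.
rewrite /euler_coef qfactS binS bin1 exprD exprS.
rewrite big_ord_recl big_ord_recr /= subn0.
under eq_bigr => i _ do rewrite /bump /= subSS.
have Q0 := qfact_neq0 k pX_neq1.
have := pX_neq1 k; case: (leqP k N) => [leN|ltN] p1.
  have EN : p ^+ N = p ^+ (N - k) * p ^+ k by rewrite -exprD subnK.
  move: Q0 p1; rewrite !exprS EN.
  move: (\prod_(i < k) _) (qfact p k) (p ^+ (N - k)) (p ^+ k) (p ^+ 'C(k, 2)) ((-1) ^+ k).
  by move=> z Q u v w s Q0 p1; field; rewrite Q0 p1.
rewrite [\prod_(i < k) _](bigD1 (Ordinal ltN)) //= subnn expr0 subrr.
by rewrite !(mul0r, mulr0) subr0.
Qed.

Lemma euler_coef_big N k : (N < k)%N -> euler_coef N k = 0.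
Proof.
move=> ltN; rewrite /euler_coef (bigD1 (Ordinal ltN)) //= subnn expr0 subrr.
by rewrite mul0r mulr0.
Qed.

Lemma finite_euler (z : {poly K}) N :
  \prod_(i < N) (1 - p ^+ i *: z) = \sum_(k < N.+1) euler_coef N k *: z ^+ k.
Proof.
elim: N => [|N IH]; first by rewrite big_ord0 big_ord1 euler_coef0 scale1r.
rewrite big_ord_recr /= IH mulrBr mulr1 [RHS]big_ord_recl /= euler_coef0 scale1r.
under [X in _ = _ + X]eq_bigr => k _ do
  rewrite /bump /= add1n euler_coefSS scalerBl.
rewrite sumrB addrA; congr (_ - _).
  rewrite big_ord_recl /= euler_coef0 scale1r big_ord_recr /=.
  by rewrite (@euler_coef_big N N.+1) // scale0r addr0.
rewrite mulr_suml; apply: eq_bigr => k _.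
by rewrite -scalerAl -scalerAr scalerA exprSr [p ^+ N * _]mulrC.
Qed.

End Euler.

Section Limits.
Local Open Scope classical_set_scope.
Variables (K : numFieldType) (p : K).
Hypothesis pX_neq1 : forall i, 1 - p ^+ i.+1 != 0.
Hypothesis cvg_pX : p ^+ N @[N --> \oo] --> (0 : K).

(** The coefficients in Euler's expansion of [(z; p)_oo] in powers of [z]. *)
Definition euler_lim k : K := (-1) ^+ k * p ^+ 'C(k, 2) / qfact p k.

Lemma cvg_euler_coef k : euler_coef p N k @[N --> \oo] --> euler_lim k.
Proof.
have c i : 1 - p ^+ (N - i) @[N --> \oo] --> (1 : K).
  have := cvgB (@cvg_cst _ (1 : K) _ \oo _) cvg_pX; rewrite subr0 => c0.
  rewrite -(cvg_shiftn i) /=.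
  under eq_cvg do rewrite addnK.
  exact: c0.
have P : \prod_(i < k) (1 - p ^+ (N - i)) @[N --> \oo] --> (1 : K).
  elim: k => [|k IH]; first by under eq_cvg do rewrite big_ord0; exact: cvg_cst.
  under eq_cvg do rewrite big_ord_recr /=.
  by have := cvgM IH (c k); rewrite mulr1; apply.
by have := cvgM (@cvg_cst _ (euler_lim k) _ \oo _) P; rewrite mulr1; apply.
Qed.

Lemma pochinf_X (d : nat) (y : K) m : (0 < d)%N ->
  pochinf (y *: 'X^d) p m = if (d %| m)%N then euler_lim (m %/ d) * y ^+ (m %/ d) else 0.
Proof.
move=> d_gt0; apply: cvg_lim; first exact: norm_hausdorff.
have E N : (\prod_(i < N) (1 - p ^+ i *: (y *: 'X^d)))`_m =
   if (d %| m)%N then euler_coef p N (m %/ d) * y ^+ (m %/ d) else 0.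
  rewrite finite_euler // coef_sum.
  under eq_bigr => k _ do rewrite exprZn -exprM scalerA coefZ coefXn.
  case: ifP => [/dvdnP[r ->]|ndvd].
    under eq_bigr => k _ do rewrite mulnC eqn_pmul2l //.
    rewrite mulnK //; have [ltr|ler] := ltnP r N.+1.
      rewrite (bigD1 (Ordinal ltr)) //= eqxx mulr1 big1 ?addr0 // => i.
      by rewrite -val_eqE /= eq_sym => /negbTE ->; rewrite mulr0.
    rewrite euler_coef_big // mul0r big1 // => i _.
    by rewrite gtn_eqF ?mulr0 //; exact: leq_trans (ltn_ord i) ler.
  rewrite big1 // => i _; case: eqP => [mE|]; last by rewrite mulr0.
  by rewrite mE dvdn_mulr in ndvd.
under eq_cvg do rewrite E.
case: ifP => _; last exact: cvg_cst.
apply: cvgM; last exact: cvg_cst.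
exact: cvg_euler_coef.
Qed.

End Limits.

(** * The quotient [(yt)_oo / (xt)_oo] *)

Section Cauchy.
Variables (K : numFieldType) (q : K).
Hypothesis qX_neq1 : forall i, 1 - q ^+ i.+1 != 0.

Lemma euler_limS k : (1 - q ^+ k.+1) * euler_lim q k.+1 = - q ^+ k * euler_lim q k.
Proof.
rewrite /euler_lim qfactS binS bin1 exprD (exprS (-1)).
have Q0 := qfact_neq0 k qX_neq1.
by have q1 := qX_neq1 k; field; rewrite Q0.
Qed.

Definition cauchy_coef (x y : K) m : K := \prod_(r < m) (x - y * q ^+ r) / qfact q m.

Lemma cauchy_coefS x y m :
  (1 - q ^+ m.+1) * cauchy_coef x y m.+1 = (x - y * q ^+ m) * cauchy_coef x y m.
Proof.
rewrite /cauchy_coef qfactS big_ord_recr /=.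
have Q0 := qfact_neq0 m qX_neq1.
by have q1 := qX_neq1 m; field; rewrite Q0.
Qed.

(** The [q]-binomial theorem, as [G E_x = E_y] for [G] the series with coefficients
[cauchy_coef] and [E_z] the series of [(zt)_oo]. The functional equations
[(1 - x t) G(t) = (1 - y t) G(q t)] and [E_x(t) = (1 - x t) E_x(q t)] show that
[H = G E_x] satisfies [H(t) = (1 - y t) H(q t)], which determines [H] from [H(0) = 1].
On coefficients, the last equation is
[(1 - q^(m + 1)) H_(m + 1) = - y q^m H_m]. *)
Lemma cauchy_binomial x y m :
  fps_mul (cauchy_coef x y) (fun k => euler_lim q k * x ^+ k) m = euler_lim q m * y ^+ m.
Proof.
pose E k := euler_lim q k * x ^+ k; rewrite -/E.
elim: m => [|m IH].
  rewrite /fps_mul big_ord1 /E /cauchy_coef /euler_lim !qfact0 big_ord0 !expr0.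
  by rewrite invr1 !mulr1.
apply: (mulfI (qX_neq1 m)); rewrite mulrA euler_limS.
transitivity (- q ^+ m * y * fps_mul (cauchy_coef x y) E m); last first.
  by rewrite IH exprS; ring.
have ES k : (1 - q ^+ k.+1) * E k.+1 = - x * q ^+ k * E k.
  by rewrite /E mulrA euler_limS exprS; ring.
(* 1 - q^(m + 1) = (1 - q^(m + 1 - i)) + q^(m + 1 - i) (1 - q^i), and each part
   lowers the index of one of the two factors. *)
transitivity (\sum_(i < m.+2) cauchy_coef x y i * ((1 - q ^+ (m.+1 - i)) * E (m.+1 - i)%N) +
    \sum_(i < m.+2) q ^+ (m.+1 - i) * ((1 - q ^+ i) * cauchy_coef x y i) * E (m.+1 - i)%N).
  rewrite -big_split mulr_sumr; apply: eq_bigr => i _ /=.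
  have <- : q ^+ (m.+1 - i) * q ^+ i = q ^+ m.+1 by rewrite -exprD subnK // -ltnS.
  ring.
rewrite big_ord_recr [X in _ + X]big_ord_recl /= subnn subrr !(mul0r, mulr0) addr0 add0r.
rewrite -big_split mulr_sumr; apply: eq_bigr => i _ /=.
have lei : (i <= m)%N by rewrite -ltnS.
rewrite /bump /= add1n subSS cauchy_coefS subSn // ES.
have -> : q ^+ m = q ^+ (m - i) * q ^+ i by rewrite -exprD subnK.
by ring.
Qed.

End Cauchy.

(** * The coefficients of the generating function *)

Lemma sum_even (V : nmodType) n (f : nat -> V) :
  \sum_(i < n.+1) (if (2 %| i)%N then f (i %/ 2)%N else 0) =
  \sum_(k < n.+1 | (2 * k <= n)%N) f k.
Proof.
rewrite -big_mkcond /=.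
rewrite (reindex_onto (fun k : 'I_n.+1 => inord (2 * k) : 'I_n.+1)
                      (fun i : 'I_n.+1 => inord (i %/ 2) : 'I_n.+1)) /=; last first.
  move=> i di; have := ltn_ord i => lti.
  by apply: val_inj; rewrite /= !inordK ?muln_divA // ?mulKn //; lia.
apply: eq_big => k; last first.
  move: (inord (2 * k)) => j /andP[_ /eqP <-]; rewrite inordK //.
  exact: leq_ltn_trans (leq_div _ _) (ltn_ord _).
rewrite -val_eqE /=; have [le2k|lt2k] := leqP (2 * k) n.
  by rewrite inordK // dvdn_mulr //= mulKn // inordK // eqxx.
(* Out of range, inord (2 * k) is 0, and k is not 0. *)
rewrite [inord (2 * k)]/inord /insubd insubF ?ltnS 1?leqNgt ?lt2k //=.
by rewrite div0n inordK //; apply/negbTE; lia.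
Qed.

Section HermiteCoefficients.
Local Open Scope classical_set_scope.

(** The series of [(t^2;q^2)_oo] has only even powers of [t]; the index [k] stands
for the power [t^(2k)]. *)
Lemma hermiteE (K : numFieldType) (x y q : K) n :
  (forall i, 1 - q ^+ i.+1 != 0) -> q ^+ N @[N --> \oo] --> (0 : K) ->
  hermite x y q n = \sum_(k < n.+1 | (2 * k <= n)%N)
    qfact q n * (euler_lim (q ^+ 2) k * cauchy_coef q x y (n - 2 * k)).
Proof.
move=> qX cvg_q.
have q2X := sqrX_neq1 qX.
have cvg_q2 : (q ^+ 2) ^+ N @[N --> \oo] --> (0 : K).
  have := cvgM cvg_q cvg_q; rewrite mulr0.
  by under [X in _ -> X]eq_cvg do rewrite exprAC expr2; apply.
have E1 z : pochinf (z *: 'X) q =1 fun k => euler_lim q k * z ^+ k.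
  by move=> k; rewrite (@pochinf_X _ _ qX cvg_q 1) // dvd1n divn1.
have E2 : pochinf 'X^2 (q ^+ 2) =1
    fun k => if (2 %| k)%N then euler_lim (q ^+ 2) (k %/ 2) else 0.
  by move=> k; rewrite -[in LHS](scale1r 'X^2) (pochinf_X q2X cvg_q2) // expr1n mulr1.
rewrite /hermite -mulr_sumr -fps_mulA; congr (_ * _).
have G : fps_mul (pochinf (y *: 'X) q) (fps_inv (pochinf (x *: 'X) q)) =1 cauchy_coef q x y.
  apply: fps_divE => [|m].
    by rewrite E1 /euler_lim qfact0 !expr0 invr1 !mulr1 oner_eq0.
  by rewrite E1 -(cauchy_binomial qX x); apply: eq_fps_mul => // k; rewrite E1.
rewrite (eq_fps_mul E2 G) /fps_mul.
rewrite -(sum_even n (fun k => euler_lim (q ^+ 2) k * cauchy_coef q x y (n - 2 * k))).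
apply: eq_bigr => i _; case: ifP => [di|]; last by rewrite mul0r.
by rewrite muln_divA // mulKn.
Qed.

End HermiteCoefficients.

(** The scaling of [x] and [y] produces [sqrt (1 - q)] to the power [n - 2k], so
that the factor [(1 - q)^(-k)] of [qcount] remains. *)
Lemma hermite_starE (C : numClosedFieldType) (x y q : C) n :
  (forall i, 1 - q ^+ i.+1 != 0) -> (q ^+ N @[N --> \oo] --> (0 : C))%classic ->
  hermite_star x y q n = \sum_(k < n.+1 | (2 * k <= n)%N)
    (-1) ^+ k * q ^+ (2 * 'C(k, 2)) * qcount q (n - 2 * k) k *
    \prod_(r < n - 2 * k) (x - y * q ^+ r).
Proof.
move=> qX cvg_q; rewrite /hermite_star hermiteE // mulr_sumr.
apply: eq_bigr => k le2k; rewrite /qcount subnK // /cauchy_coef /euler_lim -exprM.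
set s := sqrtC (1 - q).
have s2 : s ^+ 2 = 1 - q by rewrite sqrtCK.
have s0 : s != 0 by rewrite sqrtC_eq0; exact: (qX 0%N).
have -> : \prod_(r < n - 2 * k) (x * s - y * s * q ^+ r) =
    s ^+ (n - 2 * k) * \prod_(r < n - 2 * k) (x - y * q ^+ r).
  rewrite -[in s ^+ _](card_ord (n - 2 * k)) -prodr_const -big_split.
  by apply: eq_bigr => r _ /=; ring.
rewrite -s2 -exprM -{1}(subnK le2k) exprD.
have Q0 := qfact_neq0 (n - 2 * k) qX.
have D0 := qfact_neq0 k (sqrX_neq1 qX).
have [u0 v0] := (expf_neq0 (n - 2 * k) s0, expf_neq0 (2 * k) s0).
move: Q0 D0 u0 v0.
move: (\prod_(r < _) _) (qfact q (n - 2 * k)) (qfact (q ^+ 2) k) (s ^+ (n - 2 * k)) (s ^+ (2 * k)).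
by move=> z Q D u v Q0 D0 u0 v0; field; rewrite Q0 D0 u0 v0.
Qed.

(** * The theorem *)

Local Open Scope complex_scope.

Theorem theorem5p2 (R : realType) (q : R) (x y : R[i]) (n : nat) :
  0 < q -> q < 1 ->
  hermite_star x y q%:C n = \sum_(pi in FBM n) wt x y q%:C pi.
Proof.
move=> q_gt0 q_lt1.
have qX i : 1 - q%:C ^+ i.+1 != 0 :> R[i].
  rewrite -rmorphXn -[1](rmorph1 (real_complex R)) -rmorphB fmorph_eq0 subr_eq0.
  by rewrite gt_eqF // exprn_ilt1 // ltW.
rewrite sum_wt // hermite_starE //.
apply/cvgr0Pnorm_lt => -[e e'] /=; rewrite ltcE /= => /andP[/eqP -> e_gt0].
have /cvgr0Pnorm_lt/(_ e e_gt0) : (q ^+ N @[N --> \oo] --> (0 : R))%classic.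
  by apply: cvg_expr; rewrite gtr0_norm.
have qN_ge0 N : 0 <= q ^+ N by rewrite exprn_ge0 // ltW.
apply: filterS => N; rewrite (ger0_norm (qN_ge0 N)) -rmorphXn /= ger0_norm ?ler0c //.
by rewrite ltcR.
Qed.
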